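(* Let $T':S^3\hookrightarrow S^2\times S^3$ be an embedding. The Serre fibration $\mathrm{Diff}(S^2\times S^3)\to\mathrm{Emb}(S^3,S^2\times S^3)$, $f\mapsto f\circ T'$, is not surjective.
   Context: $\mathrm{Diff}(S^2\times S^3)$ is the group of all smooth diffeomorphisms and $\mathrm{Emb}(S^3,S^2\times S^3)$ the space of smooth embeddings, both with the $C^\infty$-topology. The map $f\mapsto f\circ T'$ is a locally trivial Serre fibration (onto its image). *)

(* Defs.v *)
From mathcomp Require Import all_boot all_order all_algebra.
From mathcomp Require Import all_classical all_reals all_analysis.
Set Implicit Arguments.
Unset Strict Implicit.
Unset Printing Implicit Defensive.
Import Order.TTheory GRing.Theory Num.Theory.
Import numFieldNormedType.Exports.
Local Open Scope classical_set_scope.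
Local Open Scope ring_scope.

(* All normed modules below are meant to be finite dimensional; asking for all
   directional derivatives to be C^k is then the usual definition of C^(k+1) for
   maps on an open set U. *)
Fixpoint Ck_on (R : realType) (V W : normedModType R) (k : nat) (U : set V)
    (f : V -> W) : Prop :=
  if k is k'.+1 then
    (forall x, U x -> differentiable f x) /\
    (forall v : V, Ck_on k' U (fun x => 'D_v f x))
  else forall x, U x -> {for x, continuous f}.

Definition smooth_on (R : realType) (V W : normedModType R) (U : set V)
    (f : V -> W) : Prop :=
  forall k, Ck_on k U f.

(* Submanifolds are represented by subsets A of an ambient space. A map between
   them is smooth when, near every point, it is the restriction of a C^oo map
   defined on an open subset of the ambient space. *)
Definition local_extension (R : realType) (V W : normedModType R) (A : set V)
    (B : set W) (f : A -> B) (p : A) (F : V -> W) : Prop :=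
  exists U : set V, [/\ open U, U (set_val p), smooth_on U F &
    forall q : A, U (set_val q) -> F (set_val q) = set_val (f q)].

Definition smooth_map (R : realType) (V W : normedModType R) (A : set V)
    (B : set W) (f : A -> B) : Prop :=
  forall p : A, exists F : V -> W, local_extension f p F.

(* v is the velocity at p of a smooth curve lying in A *)
Definition tangent (R : realType) (V : normedModType R) (A : set V) (p : V) :
    set V :=
  [set v | exists (c : R -> V) (U : set R),
    [/\ open U, U 0, smooth_on U c, c @` U `<=` A & c 0 = p /\ 'D_1 c 0 = v]].

(* On tangent vectors at p, 'd F p does not depend on the extension F of f: it
   is the differential of f at p. *)
Definition immersion (R : realType) (V W : normedModType R) (A : set V)
    (B : set W) (f : A -> B) : Prop :=
  forall p : A, exists2 F : V -> W, local_extension f p F &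
    forall v, tangent A (set_val p) v -> 'd F (set_val p) v = 0 -> v = 0.

(* homeomorphism onto the image, A and B having their subspace topologies *)
Definition topological_embedding (X Y : topologicalType) (f : X -> Y) : Prop :=
  [/\ continuous f, injective f &
    forall O : set X, open O ->
      exists2 O' : set Y, open O' & f @` O = range f `&` O'].

Definition Emb (R : realType) (V W : normedModType R) (A : set V) (B : set W) :
    set (A -> B) :=
  [set f | [/\ smooth_map f, immersion f & topological_embedding f]].
Arguments Emb {R V W} A B.

Definition Diff (R : realType) (V : normedModType R) (A : set V) :
    set (A -> A) :=
  [set f | smooth_map f /\
    exists g : A -> A, [/\ smooth_map g, cancel f g & cancel g f]].
Arguments Diff {R V} A.

(* The norm of 'rV[R]_n is the sup norm, hence the explicit sum of squares. *)
Definition unit_sphere (R : realType) (n : nat) : set 'rV[R]_n.+1 :=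
  [set x | \sum_(i < n.+1) x 0 i ^+ 2 = 1].
Arguments unit_sphere R n : clear implicits.

Definition S3 (R : realType) : set 'rV[R]_4 := unit_sphere R 3.
Arguments S3 R : clear implicits.

Definition S2xS3 (R : realType) : set ('rV[R]_3 * 'rV[R]_4) :=
  unit_sphere R 2 `*` unit_sphere R 3.
Arguments S2xS3 R : clear implicits.

(* Main.v *)
Require Import Defs.
From mathcomp Require Import all_boot all_order all_algebra.
From mathcomp Require Import all_classical all_reals all_analysis.
From mathcomp Require Import ring lra.

(** Two embeddings of S^3 that differ by a diffeomorphism of S^2 x S^3 are
    simultaneously null-homotopic or not. The orbit of T' therefore cannot
    contain both of the following embeddings.
    - e1 sends p to (q, p) for a fixed point q of S^2.
    - e0 is the restriction to S^3 of an embedding E of the whole of R^4 (the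
      map [chart]), so that it extends over the ball bounded by S^3.

    If e0 = f0 o T' and e1 = f1 o T' with f0 and f1 diffeomorphisms, then
    f1 o f0^-1 o E is continuous on R^4 and restricts to e1 on S^3. Its second
    component is a continuous map from R^4 to S^3 that fixes S^3 pointwise,
    which [no_retraction_onto_sphere] forbids.

    The no-retraction theorem is derived from the Poincare-Miranda theorem: a
    retraction, precomposed with the radial projection onto the ball, is a
    nowhere zero continuous map on a cube that has on each pair of opposite
    faces the signs required there. The Poincare-Miranda theorem follows by
    compactness from a statement on labellings of a grid, [steinhaus], whose
    proof is Stokes' theorem modulo 2. The sign labels F_1, ..., F_n are
    0-cochains, and the cup product dF_1 u ... u dF_n is the coboundary of
    F_1 u dF_2 u ... u dF_n. Summed over all the cells of the grid it is
    therefore a sum over boundary faces, where all the terms vanish except for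
    those on the face on which F_1 = 1; by induction on n the sum is 1. Some
    cell thus has a nonzero cup product, and every label changes on it. *)

Set Implicit Arguments.
Unset Strict Implicit.
Unset Printing Implicit Defensive.
Import Order.TTheory GRing.Theory Num.Theory.
Import numFieldNormedType.Exports.
Local Open Scope ring_scope.

(** * Cup products of differentials modulo 2 *)

Section Cup.
Context (n : nat) (T : Type) (b : 'I_n -> T -> T).
Context (bC : forall j k x, b j (b k x) = b k (b j x)).

Lemma sum_off_diagonal_sym (S : {set 'I_n}) (a : 'I_n -> 'I_n -> bool) :
  (forall j k, a j k = a k j) -> \sum_(j in S) \sum_(k in S :\ j) a j k = 0.
Proof.
move=> aC; transitivity (\sum_(j in S) \sum_(k in S | (j < k)%N) a j k +
   \sum_(j in S) \sum_(k in S | (k < j)%N) a j k).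
  rewrite -big_split; apply: eq_bigr => j jS /=.
  rewrite (bigID (fun k : 'I_n => (j < k)%N)) /=; congr (_ + _);
    apply: eq_bigl => k; rewrite !inE -(inj_eq val_inj) /=;
    by case: ltngtP; rewrite ?andbF ?andbT.
rewrite [X in _ + X](exchange_big_dep (fun k => k \in S)) /=; last first.
  by move=> ? ? _ /andP[].
under [X in _ + X]eq_bigr => k kS.
  under eq_bigl => j do rewrite kS.
  under eq_bigr => j _ do rewrite aC.
  over.
by rewrite [LHS]addbb.
Qed.

(** The value on the cube spanned at x by the directions in S of the cup
    product of the coboundaries of the functions in fs. The cube is cut into
    simplices, one for each order in which its directions can be followed, and
    j is the first direction of that order. Booleans are the field with two
    elements. *)
Fixpoint cup (fs : seq (T -> bool)) (x : T) (S : {set 'I_n}) : bool :=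
  if fs is f :: fs' then
    \sum_(j in S) (f (b j x) + f x) * cup fs' (b j x) (S :\ j)
  else true.

Lemma setD1_swap (S : {set 'I_n}) j k : S :\ j :\ k = S :\ k :\ j.
Proof. by apply/setP => i; rewrite !inE andbCA. Qed.

(** The cup product is a cocycle: its values on the front and the back faces of
    a cube have the same sum. In the induction, the terms that are symmetric in
    the first two directions cancel in pairs, and the other ones match after
    the induction hypothesis is used on the front and on the back faces. *)
Lemma cup_closed fs x (S : {set 'I_n}) :
  \sum_(j in S) cup fs (b j x) (S :\ j) = \sum_(j in S) cup fs x (S :\ j).
Proof.
elim: fs x S => [|f fs IH] x S //=.
have exch (a : 'I_n -> 'I_n -> bool) :
    \sum_(j in S) \sum_(k in S :\ j) a j k =
    \sum_(j in S) \sum_(k in S :\ j) a k j.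
  rewrite (exchange_big_dep (fun k => k \in S)) /=; last first.
    by move=> ? ? _ /finset.setD1P[].
  apply: eq_bigr => k kS; apply: eq_bigl => j.
  by rewrite !inE kS andbT andbC eq_sym.
transitivity (\sum_(j in S) \sum_(k in S :\ j)
    f (b j x) * cup fs (b j x) (S :\ j :\ k)).
  transitivity (\sum_(j in S) \sum_(k in S :\ j)
      f (b j x) * cup fs (b k (b j x)) (S :\ j :\ k)); last first.
    by apply: eq_bigr => j _; rewrite -!mulr_sumr IH.
  under eq_bigr => j _.
    under eq_bigr => k _ do rewrite mulrDl.
    rewrite big_split /=; over.
  rewrite big_split /= sum_off_diagonal_sym ?add0r// => j k.
  by rewrite bC setD1_swap.
rewrite exch; apply/esym.
under eq_bigr => j _.
  under eq_bigr => k _ do rewrite mulrDl.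
  rewrite big_split /= -[X in _ + X]mulr_sumr IH mulr_sumr; over.
rewrite big_split /= [X in _ + X]sum_off_diagonal_sym ?addr0; last first.
  by move=> j k; rewrite setD1_swap.
by apply: eq_bigr => j _; apply: eq_bigr => k _; rewrite setD1_swap.
Qed.
End Cup.

(** * A chessboard theorem in dimension n *)

Section Grid.
Context (n N : nat).
Local Notation grid := {ffun 'I_n -> 'I_N.+1}.

(** Steps wrap around, so that they are commuting bijections; the cells that
    are summed over below, see [box], are those that do not wrap. *)
Definition step (j : 'I_n) (x : grid) : grid :=
  [ffun k => if k == j then ordS (x k) else x k].

Lemma stepC j k x : step j (step k x) = step k (step j x).
Proof.
by apply/ffunP => i; rewrite !ffunE; case: eqP; case: eqP.
Qed.

(** The lower corners of the cells with directions S that lie on the face where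
    the coordinates outside S are maximal. *)
Definition box (S : {set 'I_n}) : {set grid} :=
  [set x : grid |
    [forall j, if j \in S then x j != ord_max else x j == ord_max]].

(** Modulo 2 the interior contributions in direction j cancel; the two faces
    orthogonal to j remain. *)
Lemma sum_box_telescope (S : {set 'I_n}) j (g : grid -> bool) : j \in S ->
  \sum_(x in box S) (g (step j x) + g x) =
  \sum_(x in box (S :\ j)) g x +
  \sum_(x : grid | (x j == ord0) && [forall k, (k != j) ==>
     (if k \in S then x k != ord_max else x k == ord_max)]) g x.
Proof.
move=> jS; pose rest (x : grid) := [forall k, (k != j) ==>
  (if k \in S then x k != ord_max else x k == ord_max)].
have boxE x : (x \in box S) = (x j != ord_max) && rest x.
  rewrite inE; apply/forallP/andP => [H|[H /forallP H'] k].
    split; first by have := H j; rewrite jS.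
    by apply/forallP => k; apply/implyP.
  by have [->|kj] := eqVneq k j; [rewrite jS|have := H' k; rewrite kj].
have boxE' x : (x \in box (S :\ j)) = (x j == ord_max) && rest x.
  rewrite inE; apply/forallP/andP => [H|[H /forallP H'] k].
    split; first by have := H j; rewrite !inE eqxx.
    by apply/forallP => k; apply/implyP => kj; have := H k; rewrite !inE kj.
  by have [->|kj] := eqVneq k j; rewrite !inE ?eqxx//; have := H' k; rewrite kj.
pose back (x : grid) : grid :=
  [ffun k => if k == j then ord_pred (x k) else x k].
have stepK : cancel (step j) back.
  move=> x; apply/ffunP => k; rewrite !ffunE.
  by case: eqP => // _; rewrite ordSK.
have backK : cancel back (step j).
  move=> x; apply/ffunP => k; rewrite !ffunE.
  by case: eqP => // _; rewrite ord_predK.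
have rest_back x : rest (back x) = rest x.
  by apply: eq_forallb => k; rewrite !ffunE; case: (eqVneq k j).
rewrite big_split /= (reindex back) /=; last first.
  by apply: onW_bij; exists (step j).
under eq_bigl => x do rewrite boxE rest_back.
under eq_bigr => x _ do rewrite backK.
have maxE x : (back x j != ord_max) = (x j != ord0).
  rewrite ffunE eqxx -!(inj_eq val_inj) /=.
  case: (x j) => -[|m] /= mN; first by rewrite modn_small// eqxx.
  by rewrite modnDr modn_small ?ltn_eqF // ltnW.
under eq_bigl => x do rewrite maxE.
under [X in _ + X = _]eq_bigl => x do rewrite boxE.
under [X in _ = X + _]eq_bigl => x do rewrite boxE'.
pose s (P : pred grid) := \sum_(x | P x && rest x) g x.
have split_sum (P : pred grid) : s P + s (predC P) = \sum_(x | rest x) g x.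
  rewrite [RHS](bigID P); congr (_ + _); apply: eq_bigl => x; exact: andbC.
have := split_sum (fun x => x j == ord0).
rewrite -(split_sum (fun x => x j == ord_max)) /s /=.
by do 4 case: (\sum_(_ | _) _).
Qed.

Context (F : 'I_n -> grid -> bool).
Context (F0 : forall i (x : grid), x i = ord0 -> F i x = false).
Context (FN : forall i (x : grid), x i = ord_max -> F i x = true).

Local Notation cupF L := (cup step [seq F i | i <- L]).

(** On a face orthogonal to j the label F j is constant, so its coboundary
    vanishes and so does every product that contains it. *)
Lemma cup_face (L : seq 'I_n) (x : grid) (S : {set 'I_n}) j :
  j \in L -> j \notin S -> x j = ord0 \/ x j = ord_max ->
  cupF L x S = false.
Proof.
elim: L x S => // i L IH x S; rewrite inE => /predU1P[<-|jL] jS xj /=;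
  apply: big1 => k kS; have kj : j != k by apply: contra jS => /eqP->.
- suff -> : F j (step k x) = F j x by rewrite [_ + _]addbb mul0r.
  have e : step k x j = x j by rewrite ffunE (negbTE kj).
  by case: xj => xj; [rewrite !F0 ?e|rewrite !FN ?e].
- rewrite IH ?mulr0//; first by rewrite !inE (negbTE jS) andbF.
  by rewrite ffunE (negbTE kj).
Qed.

(** Stokes' theorem for F_i u dF_L, where i is the head of the list. *)
Lemma sum_cup_box (L : seq 'I_n) : uniq L ->
  \sum_(x in box [set i in L]) cupF L x [set i in L] = 1.
Proof.
elim: L => [_|i L IH /= /andP[iL uL]].
  rewrite (big_pred1 [ffun=> ord_max])// => x; rewrite inE /=.
  apply/forallP/eqP => [H|-> k]; last by rewrite !inE !ffunE eqxx.
  by apply/ffunP => k; have := H k; rewrite !inE ffunE => /eqP.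
set S := [set k in i :: L].
have Si : S :\ i = [set k in L].
  by apply/setP => k; rewrite !inE; case: eqVneq => //= ->; rewrite (negbTE iL).
have iS : i \in S by rewrite !inE eqxx.
pose g j x := F i x * cupF L x (S :\ j).
(* The terms F i x * cup ... added here have sum 0 over j by [cup_closed]; they
   make the sum telescope in each direction. *)
transitivity (\sum_(j in S) \sum_(x in box S) (g j (step j x) + g j x)).
  rewrite [RHS]exchange_big; apply: eq_bigr => x _; rewrite /g /=.
  under eq_bigr => j _ do rewrite mulrDl.
  rewrite !big_split /= -!mulr_sumr; congr (_ + _ * _).
  exact: (cup_closed stepC).
rewrite (bigD1 i) //= [X in _ + X]big1 ?addr0; last first.
  move=> j /andP[jS ji]; have jL : j \in L.
    by move: jS; rewrite !inE (negbTE ji).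
  rewrite sum_box_telescope// !big1 => [|x /andP[/eqP x0 _]|x xS].
  - by rewrite addr0.
  - by rewrite /g (cup_face jL) ?mulr0 ?finset.setD11//; left.
  - rewrite /g (cup_face jL) ?mulr0 ?finset.setD11//; right.
    by move: xS; rewrite inE => /forallP/(_ j); rewrite finset.setD11 => /eqP.
rewrite sum_box_telescope// [X in _ + X]big1 => [|x /andP[/eqP x0 _]].
  rewrite addr0 -(IH uL) Si; apply: eq_bigr => x.
  rewrite inE => /forallP/(_ i); rewrite inE (negbTE iL) => /eqP xi.
  by rewrite /g FN// mul1r Si.
by rewrite /g F0// mul0r.
Qed.

(** If the product is nonzero, so is its value on one of the simplices, and then
    each label changes along the corresponding path of edges. *)
Lemma cup_label_changes (L : seq 'I_n) (x : grid) (S : {set 'I_n}) i :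
  i \in L -> cupF L x S ->
  exists y y' : grid, [/\ F i y, ~~ F i y' &
    forall k, (y k = x k \/ k \in S /\ y k = ordS (x k)) /\
              (y' k = x k \/ k \in S /\ y' k = ordS (x k))].
Proof.
elim: L x S => // l L IH x S iL /=.
move=> sum1; have [j jS] : exists2 j, j \in S &
    (F l (step j x) + F l x) * cupF L (step j x) (S :\ j).
  apply/exists_inP; move: sum1; apply: contraLR; rewrite negb_exists_in.
  move=> /forall_inP H; rewrite big1// => j jS; apply/negbTE; exact: H.
move=> /andP[dF cL]; move: iL; rewrite inE => /predU1P[il|iL]; last first.
  have [y [y' [Fy Fy' yy']]] := IH _ _ iL cL; exists y, y'; split => // k.
  have [] := yy' k; rewrite !inE !ffunE.
  by case: (eqVneq k j) => [->|_] /= [->|[? ->]] // [->|[? ->]]//; auto.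
have near z : z = x \/ z = step j x ->
    forall k, z k = x k \/ k \in S /\ z k = ordS (x k).
  move=> [] -> k; [by left|rewrite ffunE].
  by case: (eqVneq k j) => [->|_]; [right|left].
subst l; case E : (F i x) dF => dF.
  exists x, (step j x); split => [//||k]; first by case: (F _ _) dF.
  by split; apply: near; auto.
exists (step j x), x; split => [||k]; rewrite ?E//; first by case: (F _ _) dF.
by split; apply: near; auto.
Qed.

(** The cup product of all the labels has sum 1 over the cells, so that it is
    nonzero on one of them. *)
Lemma steinhaus : exists x : grid, forall i,
  exists y y' : grid, [/\ F i y, ~~ F i y' &
    forall k, (x k <= y k <= (x k).+1)%N /\ (x k <= y' k <= (x k).+1)%N].
Proof.
have := sum_cup_box (enum_uniq 'I_n); set S := [set i in _] => sum1.
have ST k : k \in S by rewrite !inE mem_enum.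
have [x xS cx] : exists2 x, x \in box S & cupF (enum 'I_n) x S.
  apply/exists_inP; move: (isT : true); rewrite -[true]sum1.
  apply: contraLR; rewrite negb_exists_in => /forall_inP H.
  by rewrite big1// => x xS; apply/negbTE; exact: H.
exists x => i.
have [|y [y' [Fy Fy' yy']]] := cup_label_changes _ cx (i := i).
  by rewrite mem_enum.
exists y, y'; split => // k.
have xk : ordS (x k) = (x k).+1 :> nat.
  move: xS; rewrite inE => /forallP/(_ k); rewrite ST => xkN /=.
  by rewrite modn_small// ltnS ltn_neqAle leq_ord andbT.
have near (z : grid) : z k = x k \/ k \in S /\ z k = ordS (x k) ->
  (x k <= z k <= (x k).+1)%N.
  by move=> [->|[_ ->]]; rewrite ?xk leqnn leqnSn.
by have [/near ? /near ?] := yy' k.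
Qed.
End Grid.

Local Open Scope classical_set_scope.

(** * The Poincare-Miranda theorem *)

Definition cube (R : realType) n : set 'rV[R]_n :=
  [set x | forall i, -1 <= x 0 i <= 1].

(** This is [steinhaus] for the signs of the coordinates of G on a regular grid
    of mesh 2 / (N + 1), with p the lower corner of the cell found. *)
Lemma poincare_miranda_approx (R : realType) n (G : 'rV[R]_n -> 'rV[R]_n) N :
  (forall x i, cube x -> x 0 i = -1 -> G x 0 i <= 0) ->
  (forall x i, cube x -> x 0 i = 1 -> 0 <= G x 0 i) ->
  exists2 p, cube p & forall i, exists y y' : 'rV[R]_n,
    [/\ 0 <= G y 0 i, G y' 0 i <= 0 &
      forall k, `|p 0 k - y 0 k| <= 2 / N.+1%:R /\
                `|p 0 k - y' 0 k| <= 2 / N.+1%:R].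
Proof.
move=> G0 G1; pose N0 : R := N.+1%:R.
have N0_gt0 : 0 < N0 by rewrite ltr0n.
pose pt (x : {ffun 'I_n -> 'I_N.+2}) : 'rV[R]_n :=
  \row_k (2 * (x k)%:R / N0 - 1).
have pt_cube x : cube (pt x).
  move=> k; rewrite mxE; have xk : ((x k)%:R : R) <= N0.
    by rewrite ler_nat -ltnS.
  have xk0 : 0 <= ((x k)%:R : R) by [].
  rewrite lerBrDr addNr lerBlDr ler_pdivrMr// -mulrA ler_pM2l//.
  by rewrite !mulr_ge0 ?invr_ge0 ?ler0n//= -(natrD _ 1 1) ler_pM2l.
have pt_dist (x y : {ffun 'I_n -> 'I_N.+2}) k : (x k <= y k <= (x k).+1)%N ->
    `|pt x 0 k - pt y 0 k| <= 2 / N0.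
  rewrite leq_eqVlt => /andP[/predU1P[xy _|xy yx]].
    by rewrite !mxE xy subrr normr0 divr_ge0// ltW.
  have yk : (y k : nat) = (x k).+1 by apply/eqP; rewrite eqn_leq yx xy.
  rewrite !mxE yk opprB addrA subrK -mulrBl -mulrBr -[in X in _ - X]natr1.
  rewrite opprD addrA subrr add0r mulrN1 mulNr normrN ger0_norm//.
  by rewrite divr_ge0// ltW.
(* On the top face the label has to be true even where G vanishes; as G is
   nonnegative there, a true label still means 0 <= G. *)
pose sgn (i : 'I_n) x := (0 < G (pt x) 0 i) || (x i == ord_max).
have [|i x xi|x xN] := @steinhaus n N.+1 sgn.
- move=> i x xi; rewrite /sgn xi orbF; apply/negbTE; rewrite -leNgt.
  by apply: G0 => //; rewrite mxE xi mulr0 mul0r sub0r.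
- by rewrite /sgn xi eqxx orbT.
exists (pt x) => // i; have [y [y' [sy sy' yy']]] := xN i.
exists (pt y), (pt y'); split.
- case/orP: sy => [/ltW//|/eqP yi]; apply: G1 => //.
  by rewrite mxE yi /= -/N0 mulfK ?gt_eqF//; lra.
- by move: sy'; rewrite negb_or -leNgt => /andP[].
- by move=> k; have [? ?] := yy' k; split; apply: pt_dist.
Qed.

Theorem poincare_miranda (R : realType) n (G : 'rV[R]_n -> 'rV[R]_n) :
  continuous G ->
  (forall x i, cube x -> x 0 i = -1 -> G x 0 i <= 0) ->
  (forall x i, cube x -> x 0 i = 1 -> 0 <= G x 0 i) ->
  exists2 x, cube x & G x = 0.
Proof.
move=> Gc G0 G1.
have /(_ _)/cid2 := poincare_miranda_approx _ G0 G1.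
move=> /all_sig2[u u_cube u_sgn].
(* A cluster point of the approximate zeros is a zero. *)
have cube_compact : compact (@cube R n).
  pose I : set R := `[-1, 1]%classic.
  have -> : @cube R n = [set v : 'rV[R]_n | forall i, I (v ord0 i)].
    by apply/seteqP; split => v vP i; have := vP i; rewrite /I /= in_itv.
  by apply: (@rV_compact _ n (fun=> I)) => _; exact: segment_compact.
have [p [p_cube p_cluster]] := cube_compact (u @ \oo) _
  (filterE _ u_cube).
exists p => //; apply/rowP => i; rewrite mxE.
have Gic : {for p, continuous (fun x => G x 0 i)}.
  apply: (@continuous_comp _ _ _ G (fun v : 'rV[R]_n => v 0 i)).
    exact: Gc.
  exact: coord_continuous.
have close (P : set 'rV[R]_n) : nbhs p P -> exists N, forall y : 'rV[R]_n,
    (forall k, `|u N 0 k - y 0 k| <= 2 / N.+1%:R) -> P y.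
  move=> /nbhs_ballP[e /= e0 eP].
  have [M _ MP] := near_infty_natSinv_lt (PosNum (divr_gt0 e0 (ltr0Sn _ 3))).
  have tailM : (u @ \oo) (u @` [set N | (M <= N)%N]).
    by exists M => // N MN; exists N.
  have ballp : nbhs p (ball p (e / 2)) by apply/nbhsx_ballx/divr_gt0.
  have [_ [[N MN <-] [_ /(_ 0) uNp]]] := p_cluster _ _ tailM ballp.
  exists N => y uy; apply: eP; split=> // a k; rewrite ord1.
  have := uNp k; rewrite /ball /= => uNpk.
  have uyk := uy k; have /= MPN := MP N MN.
  rewrite (le_lt_trans (ler_distD (u N 0 k) _ _))//.
  rewrite [ltRHS]splitr ltr_leD// (le_trans uyk)//.
  by move: MPN; move: (N.+1%:R^-1) => t; lra.
apply/eqP; rewrite eq_le !leNgt; apply/andP; split; apply/negP => Gp.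
- have [N NP] := close _ (Gic _ (lt_nbhsr Gp)).
  have [y [y' [_ y'0 yy']]] := u_sgn N i.
  have /= := NP y' (fun k => (yy' k).2); rewrite ltNge y'0 //.
- have [N NP] := close _ (Gic _ (lt_nbhsl Gp)).
  have [y [y' [y0 _ yy']]] := u_sgn N i.
  have /= := NP y (fun k => (yy' k).1); rewrite ltNge y0 //.
Qed.

(** * Calculus of globally smooth maps *)

Section Smooth.
Context {R : realType} {V : normedModType R}.
Implicit Types W : normedModType R.

Lemma Ck_on_pred W k (f : V -> W) : Ck_on k.+1 setT f -> Ck_on k setT f.
Proof.
elim: k f => [|k IH] f [df Df] /=; last by split=> // v; apply: IH.
by move=> x _; apply/differentiable_continuous/df.
Qed.

(** As f is differentiable on the whole space, a formula for its derivative is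
    an equality of functions, which can be substituted in [Ck_on]; on a smaller
    domain the formula would only hold pointwise there. *)
Lemma Ck_onS W k (f : V -> W) (Df : V -> V -> W) :
  (forall x, differentiable f x) ->
  (forall v x, 'D_v f x = Df v x) -> (forall v, Ck_on k setT (Df v)) ->
  Ck_on k.+1 setT f.
Proof.
move=> df DfE CDf; split=> [x _ //|v].
by have /funext -> := DfE v.
Qed.

Lemma smooth_cst W (w : W) : smooth_on setT (fun _ : V => w).
Proof.
move=> k; elim: k w => [|k IH] w; first by move=> x _; exact: cst_continuous.
by apply: (Ck_onS (Df := fun _ _ => 0)) => // v x; exact: derive_cst.
Qed.

Lemma smooth_id : smooth_on setT (fun x : V => x).
Proof.
case=> [|k]; first by move=> x _; exact: cvg_id.
apply: (Ck_onS (Df := fun v _ => v)) => // [v x|v]; first exact: derive_id.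
exact: smooth_cst.
Qed.

Lemma Ck_onD W k (f g : V -> W) :
  Ck_on k setT f -> Ck_on k setT g -> Ck_on k setT (fun x => f x + g x).
Proof.
elim: k f g => [|k IH] f g.
  by move=> cf cg x _; apply: continuousD; [exact: cf|exact: cg].
move=> [df Df] [dg Dg];
apply: Ck_onS (fun v => IH _ _ (Df v) (Dg v)) => [x|v x].
  by apply: differentiableD; [exact: df|exact: dg].
by apply: deriveD; apply: diff_derivable; [exact: df|exact: dg].
Qed.

Lemma Ck_onM k (f g : V -> R) :
  Ck_on k setT f -> Ck_on k setT g -> Ck_on k setT (fun x => f x * g x).
Proof.
elim: k f g => [|k IH] f g.
  by move=> /= cf cg x _; apply: continuousM; [exact: cf|exact: cg].
move=> Cf Cg; have [[df Df] [dg Dg]] := (Cf, Cg).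
have [/Ck_on_pred Cf' /Ck_on_pred Cg'] := (Cf, Cg).
apply: (Ck_onS (Df := fun v x => f x * 'D_v g x + g x * 'D_v f x)) => [x|v x|v].
- by apply: differentiableM; [exact: df|exact: dg].
- by apply: deriveM; apply: diff_derivable; [exact: df|exact: dg].
- exact: Ck_onD (IH _ _ Cf' (Dg v)) (IH _ _ Cg' (Df v)).
Qed.

Lemma Ck_onV k (f : V -> R) : (forall x, f x != 0) ->
  Ck_on k setT f -> Ck_on k setT (fun x => (f x)^-1).
Proof.
move=> f0; elim: k => [|k IH].
  by move=> /= cf x _; apply: continuousV => //; exact: cf.
move=> Cf; have [df Df] := Cf; have Ci := IH (Ck_on_pred Cf).
apply: (Ck_onS (Df := fun v x => -1 * ((f x)^-1 * (f x)^-1) * 'D_v f x))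
  => [x|v x|v].
- by apply: differentiableV => //; exact: df.
- rewrite deriveV//; last exact/diff_derivable/df.
  by rewrite mulN1r expr2 invfM.
- apply: Ck_onM (Df v); apply: Ck_onM; [exact: smooth_cst|exact: Ck_onM].
Qed.

Lemma Ck_onZl W k (f : V -> R) (w : W) :
  Ck_on k setT f -> Ck_on k setT (fun x => f x *: w).
Proof.
elim: k f => [|k IH] f.
  by move=> /= cf x _; apply: cvgZr_tmp; exact: cf.
move=> [df Df]; apply: Ck_onS (fun v => IH _ (Df v)) => [x|v x].
  exact/differentiableZl/df.
have dfx := df x I.
by rewrite !deriveE ?diffZl//; exact: differentiableZl.
Qed.

Lemma Ck_on_pair (W1 W2 : normedModType R) k (f : V -> W1) (g : V -> W2) :
  Ck_on k setT f -> Ck_on k setT g -> Ck_on k setT (fun x => (f x, g x)).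
Proof.
elim: k f g => [|k IH] f g.
  by move=> /= cf cg x _; apply: cvg_pair; [exact: cf|exact: cg].
move=> [df Df] [dg Dg];
apply: Ck_onS (fun v => IH _ _ (Df v) (Dg v)) => [x|v x].
  by apply: differentiable_pair; [exact: df|exact: dg].
have [dfx dgx] := (df x I, dg x I).
by rewrite !deriveE ?diff_pair//; exact: differentiable_pair.
Qed.

Lemma smooth_sum W n (f : 'I_n -> V -> W) : (forall i, smooth_on setT (f i)) ->
  smooth_on setT (fun x => \sum_i f i x).
Proof.
move=> sf k; elim: n f sf => [|n IH] f sf.
  by under eq_fun do rewrite big_ord0; exact: smooth_cst.
under eq_fun do rewrite big_ord_recl.
by apply: Ck_onD; [exact: sf|apply: IH => i; exact: sf].
Qed.

Lemma smooth_row n (f : 'I_n -> V -> R) : (forall i, smooth_on setT (f i)) ->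
  smooth_on setT (fun x => \row_i f i x).
Proof.
move=> sf; have -> : (fun x => \row_i f i x) =
    fun x => \sum_i f i x *: (delta_mx 0 i : 'rV_n).
  apply/funext => x; rewrite [LHS]row_sum_delta.
  by apply: eq_bigr => i _; rewrite mxE.
by apply: smooth_sum => i k; apply: Ck_onZl; exact: sf.
Qed.

Lemma differentiable_row n (f : 'I_n -> V -> R) x :
  (forall i, differentiable (f i) x) ->
  differentiable (fun x => \row_i f i x) x.
Proof.
move=> df; have -> : (fun x => \row_i f i x) =
    \sum_i fun x => f i x *: (delta_mx 0 i : 'rV_n).
  apply/funext => y; rewrite [LHS]row_sum_delta fct_sumE.
  by apply: eq_bigr => i _; rewrite mxE.
by apply: differentiable_sum => i; exact: differentiableZl.
Qed.
End Smooth.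

Lemma smooth_coord (R : realType) n (i : 'I_n) :
  smooth_on setT (fun x : 'rV[R]_n => x 0 i).
Proof.
case=> [|k]; first by move=> x _; exact: coord_continuous.
apply: (Ck_onS (Df := fun v _ : 'rV[R]_n => v 0 i)) => [x|v x|v].
- exact: differentiable_coord.
- have /matrixP/(_ 0 i) := derive_mx (@derivable_id _ _ x v).
  by rewrite derive_id mxE.
- exact: smooth_cst.
Qed.

(** * Maps between subsets and embeddings *)

Lemma continuous_set_val (X : topologicalType) (A : set X) :
  continuous (set_val : A -> X).
Proof. exact: (@initial_continuous A X set_val). Qed.

Lemma continuous_into_subtype (X Y : topologicalType) (B : set Y) (f : X -> B) :
  continuous (fun x => set_val (f x)) -> continuous f.
Proof.
move=> cf; apply/continuousP => _ [D oD <-].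
by move/continuousP : cf => /(_ _ oD).
Qed.

Lemma smooth_map_continuous (R : realType) (V W : normedModType R) (A : set V)
  (B : set W) (f : A -> B) : smooth_map f -> continuous f.
Proof.
move=> sf; apply: continuous_into_subtype => p.
have [F [U [oU Up sF Ff]]] := sf p.
have cF : {for set_val p, continuous F} := sF 0%N _ Up.
have vc := @continuous_set_val V A p.
have Fc := @continuous_comp _ _ _ (set_val : A -> V) F p vc cF.
rewrite /continuous_at -Ff// => P /Fc FP.
have nU : nbhs p (set_val @^-1` U) := vc _ (open_nbhs_nbhs (conj oU Up)).
suff : nbhs p (fun q => P (set_val (f q))) by [].
by apply: filterS2 nU FP => q Uq /=; rewrite Ff.
Qed.

(** The left inverse L only has to be differentiable along the image: its
    differential there makes that of F injective, and its continuity there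
    makes f open onto its image. *)
Lemma Emb_of_left_inverse (R : realType) (V W : normedModType R) (A : set V)
  (B : set W) (f : A -> B) (F : V -> W) (L : W -> V) :
  smooth_on setT F -> (forall p, F (set_val p) = set_val (f p)) ->
  cancel F L -> (forall p, A p -> differentiable L (F p)) -> Emb A B f.
Proof.
move=> sF Ff FK dL.
have ext p : local_extension f p F by exists setT; split=> //; exact: openT.
have sf : smooth_map f by move=> p; exists F.
split=> //.
- move=> p; exists F => // v _ dFv; have Ap : A (set_val p) by exact: set_valP.
  have [dF _] := sF 1%N.
  have := diff_comp (dF _ I) (dL _ Ap) => /(congr1 (fun h : V -> V => h v)) /=.
  have -> : L \o F = id by apply/funext => x; exact: FK.
  by rewrite diff_val dFv linear0.
- split; first exact: smooth_map_continuous.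
  + move=> p q fpq; apply/val_inj; rewrite -[LHS]FK -[RHS]FK.
    by congr L; rewrite [LHS]Ff [RHS]Ff fpq.
  + move=> _ [D oD <-].
    (* L need not be continuous off the image of f, whence the interior. *)
    exists (interior [set b : B | D (L (set_val b))]).
      exact: open_interior.
    apply/seteqP; split=> [_ [p Op <-]|_ [[p _ <-]]].
      split; first by exists p.
      have Ap : A (set_val p) by exact: set_valP.
      have cL : {for set_val (f p), continuous L}.
        by rewrite -Ff; apply/differentiable_continuous/dL.
      have vc := @continuous_set_val W B (f p).
      apply: (@continuous_comp _ _ _ (set_val : B -> W) L _ vc cL).
      rewrite /= -Ff FK.
      exact: open_nbhs_nbhs.
    move=> /interior_subset /=; rewrite -Ff FK => Op.
    by exists p.
Qed.

(** * A smooth embedding of R^4 into S^2 x S^3 *)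

Section Stereo.
Context {R : realType}.

Definition sqnorm n (x : 'rV[R]_n) : R := \sum_i x 0 i ^+ 2.

Lemma sqnorm_ge0 n (x : 'rV[R]_n) : 0 <= sqnorm x.
Proof. by apply: sumr_ge0 => i _; exact: sqr_ge0. Qed.

Lemma smooth_sqnorm (V : normedModType R) n (f : V -> 'rV[R]_n) :
  (forall i, smooth_on setT (fun v => f v 0 i)) ->
  smooth_on setT (fun v => sqnorm (f v)).
Proof.
by move=> sf; apply: smooth_sum => i k; apply: Ck_onM; exact: sf.
Qed.

(** Inverse stereographic projection from the point (-1, 0, ..., 0). *)
Definition stereo n (x : 'rV[R]_n) : 'rV[R]_n.+1 :=
  \row_i (if unlift ord0 i is Some j then 2 * x 0 j * (1 + sqnorm x)^-1
          else (1 - sqnorm x) * (1 + sqnorm x)^-1).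

Definition stereo_inv n (y : 'rV[R]_n.+1) : 'rV[R]_n :=
  \row_i (y 0 (lift ord0 i) * (1 + y 0 ord0)^-1).

Lemma sqnorm1_neq0 n (x : 'rV[R]_n) : 1 + sqnorm x != 0.
Proof. by rewrite gt_eqF// ltr_pwDl// sqnorm_ge0. Qed.

Lemma stereo0 n (x : 'rV[R]_n) :
  stereo x 0 ord0 = (1 - sqnorm x) * (1 + sqnorm x)^-1.
Proof. by rewrite mxE unlift_none. Qed.

Lemma stereo_lift n (x : 'rV[R]_n) i :
  stereo x 0 (lift ord0 i) = 2 * x 0 i * (1 + sqnorm x)^-1.
Proof. by rewrite mxE liftK. Qed.

Lemma stereo_sphere n (x : 'rV[R]_n) : unit_sphere R n (stereo x).
Proof.
rewrite /unit_sphere /= big_ord_recl stereo0.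
under eq_bigr do rewrite stereo_lift !exprMn.
rewrite -mulr_suml -mulr_sumr -/(sqnorm x) exprMn -mulrDl exprVn.
apply: (canLR (mulfK _)); first by rewrite sqrf_eq0 sqnorm1_neq0.
by ring.
Qed.

Lemma stereo_pole n (x : 'rV[R]_n) :
  1 + stereo x 0 ord0 = 2 * (1 + sqnorm x)^-1.
Proof. by rewrite stereo0; field; exact: sqnorm1_neq0. Qed.

Lemma stereo_pole_neq0 n (x : 'rV[R]_n) : 1 + stereo x 0 ord0 != 0.
Proof. by rewrite stereo_pole mulf_neq0 ?invr_eq0 ?sqnorm1_neq0. Qed.

Lemma stereoK n : cancel (@stereo n) (@stereo_inv n).
Proof.
move=> x; apply/rowP => i; rewrite mxE stereo_pole stereo_lift.
by field; exact: sqnorm1_neq0.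
Qed.

Lemma smooth_stereo (V : normedModType R) n (f : V -> 'rV[R]_n) :
  (forall i, smooth_on setT (fun v => f v 0 i)) ->
  smooth_on setT (fun v => stereo (f v)).
Proof.
move=> sf; have sS := smooth_sqnorm sf; apply: smooth_row => i k.
have sV : Ck_on k setT (fun v => (1 + sqnorm (f v))^-1).
  apply: Ck_onV => [v|]; first exact: sqnorm1_neq0.
  by apply: Ck_onD => //; exact: smooth_cst.
case: (unlift ord0 i) => [j|]; apply: Ck_onM => //.
  by apply: Ck_onM; [exact: smooth_cst|exact: sf].
under eq_fun do rewrite -mulN1r.
apply: Ck_onD; first exact: smooth_cst.
by apply: Ck_onM => //; exact: smooth_cst.
Qed.

(** The first coordinate is wrapped along a circle of S^2, the last three onto
    S^3. *)
Definition chart (x : 'rV[R]_4) : 'rV[R]_3 * 'rV[R]_4 :=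
  (stereo (x 0 ord0 *: (delta_mx 0 ord0 : 'rV_2)),
   stereo (\row_i x 0 (lift ord0 i))).

Definition chart_inv (y : 'rV[R]_3 * 'rV[R]_4) : 'rV[R]_4 :=
  \row_i (if unlift ord0 i is Some j
          then stereo_inv y.2 0 j else stereo_inv y.1 0 ord0).

Lemma chartK : cancel chart chart_inv.
Proof.
move=> x; apply/rowP => i; rewrite mxE !stereoK !mxE eqxx mulr1.
by case: unliftP => [j ->|->]; rewrite ?mxE.
Qed.

Lemma chart_S2xS3 x : S2xS3 R (chart x).
Proof. by split; exact: stereo_sphere. Qed.

Lemma smooth_chart : smooth_on setT chart.
Proof.
move=> k; apply: Ck_on_pair; apply: smooth_stereo => i {}k.
  under eq_fun do rewrite mxE.
  by apply: Ck_onM; [exact: smooth_coord|exact: smooth_cst].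
by under eq_fun do rewrite mxE; exact: smooth_coord.
Qed.

Lemma differentiable_fst (V W : normedModType R) (x : V * W) :
  differentiable (fst : V * W -> V) x.
Proof. by apply: linear_differentiable => y; exact: cvg_fst. Qed.

Lemma differentiable_snd (V W : normedModType R) (x : V * W) :
  differentiable (snd : V * W -> W) x.
Proof. by apply: linear_differentiable => y; exact: cvg_snd. Qed.

Lemma differentiable_chart_inv x : differentiable chart_inv (chart x).
Proof.
have quot n (f : 'rV[R]_3 * 'rV[R]_4 -> 'rV[R]_n.+1) i :
    differentiable f (chart x) -> 1 + f (chart x) 0 ord0 != 0 ->
    differentiable (fun y => stereo_inv (f y) 0 i) (chart x).
  move=> df f0; under eq_fun do rewrite mxE.
  have dc j : differentiable (fun y => f y 0 j) (chart x).
    apply: (@differentiable_comp _ _ _ _ f (fun v : 'rV[R]_n.+1 => v 0 j)).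
      exact: df.
    exact: differentiable_coord.
  apply: differentiableM => //; apply: differentiableV => //.
  by apply: differentiableD.
apply: differentiable_row => i; case: (unlift ord0 i) => [j|].
  by apply: quot; [exact: differentiable_snd|exact: stereo_pole_neq0].
by apply: quot; [exact: differentiable_fst|exact: stereo_pole_neq0].
Qed.
End Stereo.

(** * No retraction onto the sphere *)

(** With m x = max(1, |x|), the map x |-> r (x / m x) is x / m x outside the
    unit ball, hence on the faces of the cube, where it has the signs required
    by [poincare_miranda]; but it has no zero. *)
Theorem no_retraction_onto_sphere (R : realType) n
  (r : 'rV[R]_n.+1 -> 'rV[R]_n.+1) :
  continuous r -> (forall x, unit_sphere R n (r x)) ->
  ~ (forall x, unit_sphere R n x -> r x = x).
Proof.
move=> rc rS rid.
pose m (x : 'rV[R]_n.+1) := Num.max 1 (Num.sqrt (sqnorm x)).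
have m_gt0 x : 0 < m x by rewrite lt_max ltr01.
have mc : continuous m.
  move=> x.
  apply: (@continuous_max _ _ (fun=> 1) (fun x => Num.sqrt (sqnorm x))).
    exact: cst_continuous.
  apply: (@continuous_comp _ _ _ (@sqnorm R n.+1)); last exact: sqrt_continuous.
  have := @smooth_sqnorm R _ n.+1 (fun v => v) (@smooth_coord R _) 0%N.
  exact.
pose G x := r ((m x)^-1 *: x).
have Gc : continuous G.
  move=> x; apply: (@continuous_comp _ _ _ (fun x => (m x)^-1 *: x));
    last exact: rc.
  apply: continuousZ; last exact: cvg_id.
  by apply: continuousV; [rewrite gt_eqF|exact: mc].
have G_face (x : 'rV[R]_n.+1) i : `|x 0 i| = 1 -> G x = (m x)^-1 *: x.
  move=> xi; rewrite /G rid//.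
  have sq_ge1 : 1 <= sqnorm x.
    rewrite /sqnorm (bigD1 i)//= -[_ ^+ 2]ger0_norm ?sqr_ge0// normrX xi expr1n.
    by rewrite lerDl sumr_ge0// => j _; exact: sqr_ge0.
  have mE : m x = Num.sqrt (sqnorm x).
    by rewrite /m max_r// -sqrtr1 ler_sqrt// (le_trans ler01).
  rewrite /unit_sphere /=; under eq_bigr do rewrite mxE exprMn.
  rewrite -mulr_sumr -/(sqnorm x) mE exprVn sqr_sqrtr ?sqnorm_ge0//.
  by rewrite mulVf// gt_eqF// (lt_le_trans ltr01).
have [x i _ xi|x i _ xi|x _ Gx0] := poincare_miranda Gc.
- rewrite (G_face x i) ?xi ?normrN1// mxE xi mulrN1 oppr_le0.
  by rewrite invr_ge0 ltW.
- by rewrite (G_face x i) ?xi ?normr1// mxE xi mulr1 invr_ge0 ltW.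
- have := rS ((m x)^-1 *: x); rewrite -/(G x) Gx0 /unit_sphere /=.
  rewrite big1 => [/eqP|i _]; first by rewrite eq_sym oner_eq0.
  by rewrite mxE expr0n.
Qed.

(** * The theorem *)

Theorem corollary1p11 (R : realType) (T' : S3 R -> S2xS3 R) :
  Emb (S3 R) (S2xS3 R) T' ->
  ~ set_surj (Diff (S2xS3 R)) (Emb (S3 R) (S2xS3 R)) (fun f => f \o T').
Proof.
move=> _ surj.
pose c x : S2xS3 R := SigSub (mem_set (chart_S2xS3 x)).
pose e0 (p : S3 R) := c (set_val p).
have e1S (p : S3 R) : S2xS3 R (stereo 0, set_val p).
  by split; [exact: stereo_sphere|exact: set_valP].
pose e1 p : S2xS3 R := SigSub (mem_set (e1S p)).
have e0E : Emb (S3 R) (S2xS3 R) e0.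
  apply: (@Emb_of_left_inverse _ _ _ _ _ _ chart chart_inv).
  - exact: smooth_chart.
  - by [].
  - exact: chartK.
  - by move=> p _; exact: differentiable_chart_inv.
have e1E : Emb (S3 R) (S2xS3 R) e1.
  apply: (@Emb_of_left_inverse _ _ _ _ _ _ (fun x => (stereo 0, x)) snd) => //.
    by move=> k; apply: Ck_on_pair; [exact: smooth_cst|exact: smooth_id].
  by move=> p _; exact: differentiable_snd.
have [f0 [_ [g [gs f0K _]]] f0T] := surj _ e0E.
have [f1 [f1s _] f1T] := surj _ e1E.
pose r x := (set_val (f1 (g (c x)))).2.
apply: (@no_retraction_onto_sphere R 3 r) => [|x|x xS].
- have cc : continuous c.
    apply: continuous_into_subtype => x; exact: (@smooth_chart R 0%N).
  have := smooth_map_continuous f1s; have := smooth_map_continuous gs.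
  move=> gc f1c x.
  apply: (@continuous_comp _ _ _ (fun x => set_val (f1 (g (c x)))) snd);
    last exact: cvg_snd.
  apply: (@continuous_comp _ _ _ (fun x => f1 (g (c x))) set_val);
    last exact: continuous_set_val.
  apply: (@continuous_comp _ _ _ (fun x => g (c x)) f1); last exact: f1c.
  by apply: (@continuous_comp _ _ _ c g); [exact: cc|exact: gc].
- by have [] := set_valP (f1 (g (c x))).
- pose p : S3 R := SigSub (mem_set xS).
  have cx : c x = f0 (T' p) by rewrite -[f0 _]/((f0 \o T') p) f0T.
  by rewrite /r cx f0K -[f1 _]/((f1 \o T') p) f1T.
Qed.
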